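(* For any positive integer $d$ there exists a constant $c := c(d)$ such that, for every integer $n\ge d$, every $n$-vertex $d$-degenerate graph $G$ satisfies $\chi_{2\text{-vr}}(G)\le c\,n^{1/3}\log n$.
   Context: Graphs are finite, simple and undirected. A graph $G$ is $d$-degenerate if every non-empty (induced) subgraph of $G$ has a vertex of degree at most $d$ in that subgraph. For a positive integer $\ell$, an $\ell$-vertex-ranking of a graph $G$ is a colouring $\varphi$ of the vertices of $G$ with integer colours such that in every connected subgraph $H$ of $G$ with diameter at most $\ell$, there is a vertex of $H$ whose colour is larger than that of every other vertex of $H$. The $\ell$-vertex-ranking number $\chi_{\ell\text{-vr}}(G)$ is the minimum integer $k$ such that $G$ has an $\ell$-vertex-ranking $\varphi:V(G)\to\{1,\ldots,k\}$; $\chi_{2\text{-vr}}(G)$ is the case $\ell=2$.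
   Formalization: The bound is proved for n ≥ max(d, 2): the case d = n = 1 is excluded, since there log n = 0 while the one-vertex graph has 2-vertex-ranking number 1, so the claim as written fails. *)

(* Defs.v *)
From mathcomp Require Import all_boot all_order all_algebra.
From mathcomp Require Import boolp reals exp.
Set Implicit Arguments.
Unset Strict Implicit.
Unset Printing Implicit Defensive.
Import Order.TTheory GRing.Theory Num.Theory.

Record sgraph := SGraph {
  vertex :> finType;
  edge : rel vertex;
  edge_sym : symmetric edge;
  edge_irrefl : irreflexive edge }.

(* Not necessarily induced. *)
Record subgraph (G : sgraph) := SubGraph {
  sverts : {set G};
  sedge : rel G;
  sedge_sym : symmetric sedge;
  sedge_sub : forall x y, sedge x y ->
    [/\ x \in sverts, y \in sverts & edge x y] }.

Definition degenerate (d : nat) (G : sgraph) : Prop :=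
  forall S : {set G}, S != set0 ->
    exists2 v, v \in S & #|[set w in S | edge v w]| <= d.

Section Subgraphs.
Variables (G : sgraph) (H : subgraph G).

Definition connected : Prop :=
  sverts H != set0 /\
  {in sverts H &, forall x y, connect (sedge H) x y}.

Definition has_walk (x y : G) (k : nat) : bool :=
  [exists p : k.-tuple G, path (sedge H) x p && (last x p == y)].

(* Least length of a walk from x to y in H. Connected vertices are joined by a
   walk of length less than #|G|; for other pairs the value is #|G|, so dist
   and diameter are meaningful for connected H only. *)
Definition dist (x y : G) : nat := find (has_walk x y) (iota 0 #|G|).

Definition diameter : nat :=
  \max_(x in sverts H) \max_(y in sverts H) dist x y.

End Subgraphs.

Definition vertex_ranking (l : nat) (G : sgraph) (phi : G -> int) : Prop :=
  forall H : subgraph G, connected H -> diameter H <= l ->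
    exists2 v, v \in sverts H &
      forall w, w \in sverts H -> w != v -> (phi w < phi v)%R.

Definition vr_colourable (l : nat) (G : sgraph) (k : nat) : Prop :=
  exists2 phi : G -> int, vertex_ranking l phi &
    forall v, (1 <= phi v <= k%:Z)%R.

Lemma vr_colourable_card (l : nat) (G : sgraph) : vr_colourable l G #|G|.
Proof.
exists (fun v => Posz (enum_rank v).+1) => [H [/set0Pn[x0 x0H] _] _|v]; last first.
  by rewrite !lez_nat ltn_ord.
case: (arg_maxnP (fun v : G => enum_rank v : nat) x0H) => v vH vmax.
exists v => // w wH wv; rewrite ltz_nat ltnS ltn_neqAle.
apply/andP; split; last exact: vmax.
by apply: contra wv => /eqP /val_inj /enum_rank_inj ->.
Qed.

Lemma ex_vr_colourable (l : nat) (G : sgraph) :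
  exists k, `[< vr_colourable l G k >].
Proof. by exists #|G|; apply/asboolP/vr_colourable_card. Qed.

Definition vr_number (l : nat) (G : sgraph) : nat :=
  ex_minn (ex_vr_colourable l G).

(* Main.v *)
(** Order [G] so that every vertex has at most [d] earlier neighbours, its
    parents, let every vertex be a neighbour and a parent of itself, and put
    [e = d + 1], [K ~ n^(1/3)], [D = 2 e K]. Few vertices see many vertices of
    a small set: at most [#|X| / K] vertices have more than [D] neighbours in
    [X]. So the set [H] of vertices of degree above [D] has size at most [K^2],
    and the set [U1] of vertices with more than [D] neighbours in [H] has size
    at most [K].

    Colour [L = H \ U1] greedily along the order with [O(K)] colours. Two
    vertices of [L] with a common neighbour [y] outside [U1] can be separated
    unless both are parents of [y] and [y] is outside [L]; averaging over the
    free colours, the set [B] of those [y] having two parents of the same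
    colour has size [O(n / K) = O(K^2)]. Now [y] in [B] is harmless if it gets a
    larger colour. Vertices of [B] have degree at most [D], and all but the
    [O(K)] vertices of a set [U2] have at most [D] neighbours in [B], so
    [B \ U2] can be coloured greedily, and so can the remaining low-degree
    vertices. The four palettes, in decreasing order, go to [U1 :|: U2] (all
    colours distinct), [B \ U2], [L \ U2] and the rest. This uses [O(n^(1/3))]
    colours. *)
Require Import Defs.
From mathcomp Require Import all_boot all_order all_algebra.
From mathcomp Require Import boolp reals exp.
From mathcomp Require Import zify.
Set Implicit Arguments.
Unset Strict Implicit.
Unset Printing Implicit Defensive.
Import Order.TTheory GRing.Theory Num.Theory.
Local Open Scope ring_scope.

(** * Greedy colouring with an averaged weight *)

Section Greedy.
Local Open Scope nat_scope.
Variables (T : finType) (r : T -> nat) (r_inj : injective r).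
Variables (h : rel T) (wt : T -> T -> nat) (M K : nat).
Hypothesis K_gt0 : 0 < K.
Hypothesis few_earlier : forall v, #|[set u | (r u < r v) && h u v]| <= M.

Lemma averaging (I : finType) (A : {set I}) (F : I -> nat) :
  K <= #|A| -> exists2 c, c \in A & K * F c <= \sum_(i in A) F i.
Proof.
move=> KA; have /card_gt0P [i0 i0A] : 0 < #|A| by apply: leq_trans KA.
case: (arg_minnP F i0A) => c cA cmin; exists c => //.
apply: leq_trans (leq_mul KA (leqnn _)) _.
by rewrite -sum_nat_const; apply: leq_sum.
Qed.

(** At most [M] colours are blocked at each vertex, so at least [K] stay free; the free colour with
    the least clashing weight costs at most a [1/K] share of the weight towards earlier vertices.
    Values of [f] at ranks from [N] on are arbitrary. *)
Lemma greedy_colouring_upto (N : nat) : exists f : T -> 'I_(M + K),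
  (forall u v, r u < r v -> r v < N -> h u v -> f u != f v) /\
  K * (\sum_(v | r v < N) \sum_(u | (r u < r v) && (f u == f v)) wt u v)
    <= \sum_(v | r v < N) \sum_(u | r u < r v) wt u v.
Proof.
elim: N => [|N [f [fP fW]]].
  have i0 : 0 < M + K by rewrite addn_gt0 K_gt0 orbT.
  by exists (fun _ => Ordinal i0); split=> //; rewrite big_pred0_eq muln0.
(* Ranks may have gaps: without a vertex of rank [N] there is nothing to colour. *)
case: (pickP (fun v => r v == N)) => [v0 /eqP rv0|no]; last first.
  have E v : (r v < N.+1) = (r v < N).
    by rewrite ltnS leq_eqVlt no.
  exists f; split=> [u v|]; first by rewrite E; exact: fP.
  by rewrite !(eq_bigl _ _ E).
pose F : {set 'I_(M + K)} := f @: [set u | (r u < r v0) && h u v0].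
have KF : K <= #|~: F|.
  have FM : #|F| <= M by apply: leq_trans (leq_imset_card _ _) (few_earlier v0).
  by have := cardsC F; rewrite card_ord; lia.
pose g (c : 'I_(M + K)) := \sum_(u | (r u < r v0) && (f u == c)) wt u v0.
have [c cF cW] := averaging g KF.
pose f' v := if v == v0 then c else f v.
have f'E v : r v < N -> f' v = f v.
  by rewrite /f'; case: eqP => // ->; rewrite rv0 ltnn.
have f'v0 : f' v0 = c by rewrite /f' eqxx.
exists f'; split=> [u v uv|].
  rewrite ltnS leq_eqVlt => /orP[/eqP rv|rv] huv; last first.
    by rewrite !f'E //; [exact: fP|exact: ltn_trans rv].
  have vv0 : v = v0 by apply: r_inj; rewrite rv0.
  rewrite vv0 in uv huv *; rewrite f'v0 f'E -?rv0 //.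
  apply: contraTneq cF => <-; rewrite inE negbK.
  by apply: imset_f; rewrite inE uv.
have split_last (S : T -> nat) :
    \sum_(v | r v < N.+1) S v = S v0 + \sum_(v | r v < N) S v.
  rewrite (bigD1 v0) /=; last by rewrite rv0.
  congr (_ + _); apply: eq_bigl => v.
  rewrite ltnS ltn_neqAle -rv0 (inj_eq r_inj); exact: andbC.
rewrite !split_last mulnDr leq_add //.
  rewrite (eq_bigl (fun u => (r u < r v0) && (f u == c))).
    apply: leq_trans cW _; rewrite /g.
    (* Each earlier [u] counts for at most one free colour, namely [f u]. *)
    rewrite (exchange_big_dep (fun u => r u < r v0)) /=; last first.
      by move=> ? ? _ /andP[].
    apply: leq_sum => u uv0.
    rewrite (eq_bigl (fun i => (i \in ~: F) && (i == f u))); last first.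
      by move=> i; rewrite uv0 eq_sym.
    by rewrite sum_nat_const -[X in _ <= X]mul1n leq_mul2r -(cards1 (f u)) orbC
      subset_leq_card //; apply/subsetP => i; rewrite !inE => /andP[].
  by move=> u; case: ltnP => //= uv0; rewrite f'v0 f'E // -rv0.
rewrite (eq_bigr (fun v => \sum_(u | (r u < r v) && (f u == f v)) wt u v)) //.
move=> v vN; apply: eq_bigl => u; case: ltnP => //= uv.
by rewrite !f'E // (ltn_trans uv).
Qed.

Lemma greedy_colouring : exists f : T -> 'I_(M + K),
  (forall u v, r u < r v -> h u v -> f u != f v) /\
  K * (\sum_v \sum_(u | (r u < r v) && (f u == f v)) wt u v)
    <= \sum_v \sum_(u | r u < r v) wt u v.
Proof.
have [f [fP fW]] := greedy_colouring_upto (\max_v r v).+1.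
have rN v : r v < (\max_v r v).+1 by rewrite ltnS leq_bigmax.
exists f; split=> [u v uv|]; first exact: fP.
have E (S : T -> nat) : \sum_(v | r v < (\max_v r v).+1) S v = \sum_v S v.
  by apply: eq_bigl => v; rewrite rN.
by rewrite !E in fW.
Qed.

End Greedy.

Lemma card_bigcup_le (I T : finType) (P : pred I) (F : I -> {set T}) :
  (#|\bigcup_(i | P i) F i| <= \sum_(i | P i) #|F i|)%N.
Proof.
elim/big_rec2: _ => [|i m A _ IH]; first by rewrite cards0.
by rewrite cardsU; apply: leq_trans (leq_subr _ _) _; rewrite leq_add2l.
Qed.

Lemma card_bigcup_mul (I T : finType) (A : {set I}) (F : I -> {set T}) m k :
  (#|A| <= m -> (forall y, y \in A -> #|F y| <= k) ->
  #|\bigcup_(y in A) F y| <= m * k)%N.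
Proof.
move=> Am Fk; apply: leq_trans (card_bigcup_le _ _) _.
apply: (@leq_trans (\sum_(y in A) k)%N); first exact: leq_sum.
by rewrite sum_nat_const leq_mul2r Am orbT.
Qed.

(** * Degeneracy orders and a local criterion for 2-vertex-rankings *)

Section Graph.
Local Open Scope nat_scope.
Variable G : sgraph.

(** A vertex of degree at most [d] within [S] is put last, after the order obtained for the rest of
    [S]. *)
Lemma degenerate_order (d : nat) : degenerate d G ->
  exists2 r : G -> nat, injective r &
    forall v, #|[set u | edge u v && (r u < r v)]| <= d.
Proof.
move=> degG.
suff H n (S : {set G}) : #|S| = n -> exists r : G -> nat,
  [/\ {in S, forall v, r v < n}, {in S &, injective r} &
    {in S, forall v, #|[set u in S | edge u v && (r u < r v)]| <= d}].
  have [r [_ rI rd]] := H _ [set: G] erefl.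
  exists r => [u v|v]; first by apply: rI; rewrite inE.
  by have := rd v; rewrite inE => /(_ isT); rewrite (_ : [set u in _ | _] =
    [set u | edge u v && (r u < r v)]) //; apply/setP => u; rewrite !inE.
elim: n S => [|n IH] S Sn.
  by exists (fun=> 0); split=> v; rewrite (cards0_eq Sn) inE.
have /degG [v vS vd] : S != set0 by rewrite -card_gt0 Sn.
have [|r [rn rI rd]] := IH (S :\ v); first by move: Sn; rewrite (cardsD1 v) vS => -[].
have rnS x : x \in S -> x != v -> r x < n by move=> xS xv; apply: rn; rewrite !inE xv.
exists (fun x => if x == v then n else r x); split.
- by move=> x xS; case: eqP => // /eqP xv; apply: ltnW; rewrite ltnS; apply: rnS.
- move=> x y xS yS; case: eqP => [->|/eqP xv]; case: eqP => [->|/eqP yv] //.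
  + by move=> E; have := rnS y yS yv; rewrite -E ltnn.
  + by move=> E; have := rnS x xS xv; rewrite E ltnn.
  + by apply: rI; rewrite !inE ?xv ?yv.
- move=> x xS; case: (eqVneq x v) => [->|xv].
    apply: leq_trans vd; apply: subset_leq_card; apply/subsetP => u.
    by rewrite !inE edge_sym => /and3P[-> ->].
  apply: leq_trans (rd x _); last by rewrite !inE xv.
  apply: subset_leq_card; apply/subsetP => u; rewrite !inE => /and3P[uS -> ].
  by case: eqVneq => [->|_ ->]; rewrite ?uS // ltnNge ltnW // rnS.
Qed.

(** A shortened path repeats no vertex, so its length is below [#|G|] and the search in [dist]
    succeeds. *)
Lemma dist_walk (H : subgraph G) x y : connect (sedge H) x y ->
  has_walk H x y (dist H x y).
Proof.
case/connectP => p0 /shortenP[p pP up _] ->.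
have sz : size p < #|G| by have := card_uniqP up; rewrite /= => <-; exact: max_card.
have hw : has (has_walk H x (last x p)) (iota 0 #|G|).
  apply/hasP; exists (size p); first by rewrite mem_iota.
  by apply/existsP; exists (in_tuple p); rewrite /= pP eqxx.
have := nth_find 0 hw; rewrite nth_iota //.
by rewrite has_find size_iota in hw.
Qed.

(* Reflexive adjacency: a path [u - u - w] encodes the edge [u - w], so that
   properness becomes an instance of the condition on paths of length two. *)
Definition cadj : rel G := fun x y => (x == y) || edge x y.

Lemma cadj_sym : symmetric cadj.
Proof. by move=> x y; rewrite /cadj eq_sym edge_sym. Qed.

(** A second vertex of maximum colour in [H] would be at distance 1 or 2 from the first, and the
    middle of the path would exceed the maximum. *)
Lemma vertex_ranking2 (phi : G -> nat) :
  (forall u y w, u != w -> cadj u y -> cadj y w -> phi u = phi w ->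
     phi u < phi y) ->
  vertex_ranking 2 (fun v => Posz (phi v)).
Proof.
move=> phiP H [/set0Pn[x0 x0H] conn] diam.
case: (arg_maxnP phi x0H) => v vH max_v.
have vmax w : w \in sverts H -> phi w <= phi v by exact: max_v.
exists v => // w wH wv.
rewrite ltz_nat ltn_neqAle vmax // andbT; apply/negP => /eqP E.
have dvw : dist H v w <= 2.
  apply: leq_trans diam.
  apply: leq_trans (@leq_bigmax_cond _ (mem (sverts H)) _ v vH).
  exact: (@leq_bigmax_cond _ (mem (sverts H)) _ w wH).
have /existsP[p /andP[pP /eqP pw]] := dist_walk (conn v w vH wH).
case: (dist H v w) dvw p pP pw => [|[|[|//]]] _ p.
- by rewrite tuple0 /= => _ vw; rewrite vw eqxx in wv.
- case/tupleP: p => y p; rewrite tuple0 /= andbT => vy yw; subst y.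
  have [_ _ vw] := sedge_sub vy.
  (* The edge is read as the path [w - v - v]. *)
  have := phiP w v v wv; rewrite /cadj eqxx edge_sym vw orbT E ltnn.
  by move/(_ isT isT erefl).
- case/tupleP: p => y p; case/tupleP: p => z p.
  rewrite tuple0 /= andbT => /andP[vy yz] zw; subst z.
  have [_ yH evy] := sedge_sub vy; have [_ _ eyw] := sedge_sub yz.
  have := phiP v y w; rewrite eq_sym wv /cadj evy eyw !orbT E => /(_ isT isT isT erefl).
  by rewrite ltnNge vmax.
Qed.

(** * Crowded vertices and level colourings *)

Section Levels.
Variables (r : G -> nat) (r_inj : injective r) (e : nat).

Definition parent : rel G := fun u v => cadj u v && (r u <= r v).

Hypothesis few_parents : forall v, #|[set u | parent u v]| <= e.

Lemma cadj_parent u v : cadj u v = parent u v || parent v u.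
Proof. by rewrite /parent (cadj_sym v) -andb_orr leq_total andbT. Qed.

Definition nbr (X : {set G}) (y : G) : {set G} := [set u in X | cadj u y].

Definition crowded (D : nat) (X : {set G}) : {set G} := [set y | D < #|nbr X y|].

(** Count adjacent pairs between the crowded vertices and [X]: in each, one end is a parent of the
    other, and every vertex has at most [e] parents. *)
Lemma card_crowded (D : nat) (X : {set G}) :
  D * #|crowded D X| <= e * (#|crowded D X| + #|X|).
Proof.
set P := crowded D X.
rewrite mulnC -sum_nat_const.
apply: (@leq_trans (\sum_(y in P) (#|[set u | parent u y]|
   + #|[set u in X | parent y u]|))).
  apply: leq_sum => y; rewrite inE => /ltnW /leq_trans -> //.
  rewrite -cardsUI; apply: leq_trans (leq_addr _ _).
  apply: subset_leq_card; apply/subsetP => u; rewrite !inE cadj_parent.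
  by case: (u \in X).
rewrite big_split mulnDr leq_add //.
  by rewrite mulnC -sum_nat_const; apply: leq_sum.
rewrite (eq_bigr (fun y => \sum_(u in X | parent y u) 1)); last first.
  by move=> y _; rewrite sum1_card; apply: eq_card => u; rewrite inE.
rewrite (exchange_big_dep (fun u => u \in X)) /=; last by move=> ? ? _ /andP[].
rewrite mulnC -sum_nat_const; apply: leq_sum => u _.
apply: leq_trans (few_parents u); rewrite sum1_card.
by apply: subset_leq_card; apply/subsetP => y; rewrite !inE => /andP[_ /andP[]].
Qed.

Definition monochromatic (X Y : {set G}) (f : G -> nat) : {set G} :=
  [set y in Y | [exists u in X, exists w in X,
    [&& u != w, parent u y, parent w y & f u == f w]]].

(* Greedy colouring in which common neighbours in [Z] always separate, while a
   vertex of [Y :\: Z] may fail to separate two of its parents. *)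
Lemma level_colouring (X Y Z : {set G}) (D K : nat) : 0 < K ->
  {in Y, forall y, #|nbr X y| <= D} ->
  {in X, forall w, #|nbr Z w| <= D} ->
  exists f : G -> nat, [/\ forall v, f v < 2 * (e * D) + K,
    forall u y w, u \in X -> w \in X -> y \in Y -> u != w ->
      cadj u y -> cadj y w -> f u = f w -> y \in monochromatic X (Y :\: Z) f &
    K * #|monochromatic X (Y :\: Z) f| <= e ^ 2 * #|G|].
Proof.
move=> K0 degY degZ.
(* For [u] before [w], separation is forced by a common neighbour in [Y] that is a parent of [w], or
   by a common child in [Z]. Either kind rules out at most [e * D] vertices [u]. *)
pose h u w := [&& u \in X, w \in X &
  [exists y in Y, parent y w && cadj u y]
  || [exists y in Z, parent w y && parent u y]].
(* These are the [y] that become monochromatic if [u] and [w] clash. *)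
pose common u w : {set G} := [set y in Y :\: Z |
  [&& u \in X, w \in X, parent u y & parent w y]].
pose wt u w := #|common u w|.
have few v : #|[set u | (r u < r v) && h u v]| <= 2 * (e * D).
  case vX: (v \in X); last first.
    by rewrite eq_card0 // => u; rewrite !inE /h vX !andbF.
  have sub : [set u | (r u < r v) && h u v] \subset
      \bigcup_(y in [set y in Y | parent y v]) nbr X y
      :|: \bigcup_(y in nbr Z v) [set u | parent u y].
    apply/subsetP => u; rewrite inE => /and4P[_ uX _].
    rewrite inE => /orP[] /existsP[y /and3P[yYZ p1 p2]]; apply/orP.
      by left; apply/bigcupP; exists y; rewrite !inE ?yYZ ?uX.
    right; apply/bigcupP; exists y; rewrite !inE ?yYZ ?p2 //=.
    by rewrite cadj_sym; case/andP: p1.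
  apply: leq_trans (subset_leq_card sub) _.
  rewrite cardsU; apply: leq_trans (leq_subr _ _) _.
  rewrite mul2n -addnn leq_add //.
    apply: card_bigcup_mul => [|y]; last by rewrite inE => /andP[yY _]; apply: degY.
    apply: leq_trans (few_parents v); apply: subset_leq_card.
    by apply/subsetP => y; rewrite !inE => /andP[].
  by rewrite mulnC; apply: card_bigcup_mul => [|y _]; [exact: degZ|exact: few_parents].
have [f [fP fW]] := greedy_colouring r_inj wt K0 few.
exists (fun v => f v : nat); split=> [v|u y w uX wX yY uw uy yw fuw|].
- exact: ltn_ord.
- wlog ruw : u w uX wX uw uy yw fuw / r u < r w => [IH|].
    have : r u != r w by rewrite (inj_eq r_inj).
    rewrite neq_ltn => /orP[]; first exact: IH.
    rewrite cadj_sym in uy; rewrite cadj_sym in yw.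
    by apply: IH => //; rewrite eq_sym.
  have nh : ~~ h u w by apply: contraL (eqxx (f u)) => /(fP _ _ ruw); rewrite (val_inj fuw).
  move: nh; rewrite /h uX wX negb_or => /andP[/existsPn /(_ y) nA /existsPn /(_ y) nC].
  rewrite yY uy andbT /= in nA.
  (* As [y] is no parent of [w], it comes after [w], hence also after [u]. *)
  have pw : parent w y by move: yw; rewrite cadj_parent (negPf nA).
  have pu : parent u y.
    rewrite /parent uy; apply: leq_trans (ltnW ruw) _.
    by case/andP: pw.
  rewrite pw pu !andbT in nC; rewrite !inE nC yY.
  apply/existsP; exists u; rewrite uX; apply/existsP; exists w.
  by rewrite wX uw pw pu fuw eqxx.
- have sub : monochromatic X (Y :\: Z) (fun v => f v : nat) \subset
      \bigcup_w \bigcup_(u | (r u < r w) && (f u == f w)) common u w.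
    apply/subsetP => y; rewrite inE => /andP[yYZ].
    case/existsP => u /andP[uX /existsP[w /and5P[wX uw pu pw fuw]]].
    wlog ruw : u w uX wX uw pu pw fuw / r u < r w => [IH|].
      have : r u != r w by rewrite (inj_eq r_inj).
      rewrite neq_ltn => /orP[]; first exact: IH.
      by apply: IH => //; rewrite eq_sym.
    apply/bigcupP; exists w => //; apply/bigcupP; exists u; first by rewrite ruw.
    by rewrite inE yYZ uX wX pu.
  have {sub} := subset_leq_card sub.
  rewrite -(leq_pmul2l K0) => /leq_trans -> //.
  apply: leq_trans (leq_trans fW _).
    rewrite leq_pmul2l //; apply: leq_trans (card_bigcup_le _ _) _.
    by apply: leq_sum => w _; exact: card_bigcup_le.
  have npar y : \sum_u (parent u y : nat) <= e.
    apply: leq_trans (few_parents y); rewrite -sum1dep_card [X in _ <= X]big_mkcond.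
    by apply: leq_sum => u _; case: parent.
  (* Each [y] is counted at most once per ordered pair of its parents, so at most [e ^ 2] times. *)
  apply: (@leq_trans (\sum_w \sum_u \sum_y parent w y * parent u y)).
    apply: leq_sum => w _; rewrite big_mkcond; apply: leq_sum => u _.
    case: ifP => // _; rewrite /wt -sum1_card big_mkcond.
    apply: leq_sum => y _; rewrite inE.
    by case: (y \in _); case: (u \in X); case: (w \in X);
       case: (parent u y); case: (parent w y).
  under eq_bigr => w _ do rewrite exchange_big /=.
  rewrite exchange_big /= mulnC -sum_nat_const.
  apply: leq_sum => y _.
  under eq_bigr => w _ do rewrite -big_distrr /=.
  by rewrite -big_distrl /= -mulnn leq_mul.
Qed.

(** With [c] crowded vertices, cancelling [e] in the double count leaves [2 * K * c <= c + #|X|],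
    and [c <= K * c]. *)
Lemma card_crowded_le (K : nat) (X : {set G}) : 0 < e -> 0 < K ->
  K * #|crowded (2 * (e * K)) X| <= #|X|.
Proof.
move=> e0 K0; have := card_crowded (2 * (e * K)) X.
by set c := #|crowded _ _|; rewrite mulnCA -!mulnA leq_pmul2l //; nia.
Qed.

Lemma crowdedPn (D : nat) (X Y : {set G}) y :
  y \notin crowded D X -> Y \subset X -> #|nbr Y y| <= D.
Proof.
rewrite inE -leqNgt => yX /subsetP YX; apply: leq_trans yX.
by apply: subset_leq_card; apply/subsetP => u; rewrite !inE => /andP[/YX -> ->].
Qed.

(** * Assembling the four palettes *)

Lemma palette_lt (M i j a b : nat) : i < j -> a < M -> i * M + a < j * M + b.
Proof.
move=> ij aM; apply: leq_trans (leq_addr _ _); apply: leq_trans (leq_mul ij (leqnn M)).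
by rewrite mulSn addnC ltn_add2r.
Qed.

Lemma vr_colourable_cube (K : nat) : 0 < e -> 0 < K -> #|G| <= K ^ 3 ->
  vr_colourable 2 G ((13 * e ^ 2 + 4) * K).
Proof.
move=> e0 K0 GK.
pose D := 2 * (e * K); pose M := 2 * (e * D) + K.
pose H := crowded D setT; pose U1 := crowded D H; pose L := H :\: U1.
have cH : #|H| <= K ^ 2.
  rewrite -(leq_pmul2l K0) -expnS; apply: leq_trans GK; rewrite -cardsT.
  exact: card_crowded_le.
have cU1 : #|U1| <= K.
  rewrite -(leq_pmul2l K0) mulnn; apply: leq_trans cH.
  exact: card_crowded_le.
have LH : L \subset H by exact: subsetDl.
have [y|w|fL [fLM fLP cB]] := @level_colouring L (~: U1) L D K K0.
- by rewrite inE => yU; exact: crowdedPn yU LH.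
- by rewrite inE => /andP[wU _]; exact: crowdedPn wU LH.
set B := monochromatic L (~: U1 :\: L) fL in fLP cB.
have BU1 v : v \in B -> v \notin U1.
  by rewrite inE in_setD in_setC => /andP[/andP[]].
(* Avoiding both [U1] and [L] means avoiding [H], so vertices of [B] have low degree. *)
have BH v : v \in B -> v \notin H.
  move=> vB; have := vB; rewrite inE in_setD => /andP[/andP[+ _] _].
  by rewrite in_setD BU1.
have {}cB : #|B| <= e ^ 2 * K ^ 2.
  rewrite -(leq_pmul2l K0); apply: leq_trans cB _.
  by rewrite mulnCA -expnS leq_mul2l GK orbT.
pose U2 := crowded D B.
have cU2 : #|U2| <= e ^ 2 * K.
  rewrite -(leq_pmul2l K0) mulnCA mulnn; apply: leq_trans cB.
  exact: card_crowded_le.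
pose U := U1 :|: U2.
have cU : #|U| <= K + e ^ 2 * K.
  by rewrite cardsU; apply: leq_trans (leq_subr _ _) _; exact: leq_add.
(* With [Y = Z] no vertex can be monochromatic, so [fB] separates at every [y] outside [U]. *)
have [y|w|fB [fBM fBP _]] := @level_colouring (B :\: U2) (~: U) (~: U) D K K0.
- rewrite in_setC in_setU negb_or => /andP[_ yU2].
  by apply: crowdedPn yU2 _; exact: subsetDl.
- by rewrite in_setD => /andP[_ /BH wH]; apply: crowdedPn wH _; exact: subsetT.
pose R := ~: (U :|: H :|: B).
have degR : {in R, forall v, #|nbr R v| <= D}.
  move=> v; rewrite in_setC !in_setU !negb_or => /andP[/andP[_ vH] _].
  by apply: crowdedPn vH _; exact: subsetT.
have [y|w|fR [fRM fRP _]] := @level_colouring R R R D K K0.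
- exact: degR.
- exact: degR.
have no_mono X Y f y : y \in monochromatic X (Y :\: Y) f -> false.
  by rewrite setDv !inE.
have fUM v : v \in U -> index v (enum U) < #|U| by rewrite cardE index_mem mem_enum.
pose lev v := if v \in U then 3 else if v \in B then 2 else if v \in H then 1 else 0.
pose col v := if v \in U then index v (enum U) else if v \in B then fB v
  else if v \in H then fL v else fR v.
(* The top palette may be longer than [M], as no palette lies above it. *)
have colM v : lev v < 3 -> col v < M.
  rewrite /lev /col; case: ifP => // _.
  by case: ifP => _ _; [exact: fBM|case: ifP => _; [exact: fLM|exact: fRM]].
have lev_le v : lev v <= 3 by rewrite /lev; do ?case: ifP.
pose phi v := 1 + lev v * M + col v.
have phi_lt v v' : lev v < lev v' -> phi v < phi v'.
  move=> vv'; rewrite /phi -!addnA ltn_add2l; apply: palette_lt => //.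
  by apply: colM; apply: leq_trans vv' (lev_le v').
exists (fun v => Posz (phi v)); last first.
  move=> v; rewrite !lez_nat; apply/andP; split; first by rewrite /phi -addnA.
  (* Here [M = 4 * e ^ 2 * K + K] and [#|U| <= K + e ^ 2 * K]. *)
  apply: (@leq_trans (#|U| + 3 * M)); last first.
    by apply: leq_trans (leq_add cU (leqnn _)) _; rewrite /M /D -mulnn; clear; lia.
  case: (boolP (v \in U)) => vU.
    by rewrite /phi /lev /col vU addnAC add1n leq_add2r fUM.
  have v3 : lev v < 3 by rewrite /lev (negPf vU); do ?case: ifP.
  apply: leq_trans (leq_addl _ _); rewrite /phi -addnA add1n -[X in _ < X]addn0.
  by apply: palette_lt => //; exact: colM.
apply: vertex_ranking2 => u y w uw uy yw Euw.
(* What remains is [y] on a level no higher than the common level of [u] and [w]. *)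
case: (ltnP (lev u) (lev y)) => [/phi_lt //|].
have : lev u = lev w.
  by case: (ltngtP (lev u) (lev w)) => // /phi_lt; rewrite Euw ltnn.
move=> lE; have : col u = col w by move: Euw; rewrite /phi lE => /addnI.
move: lE; rewrite /lev /col.
case: (boolP (u \in U)) => uU; case: (boolP (w \in U)) => wU.
- move=> _ /(index_inj _) E; move: uw; rewrite E ?eqxx ?mem_enum //.
- by do ?case: ifP.
- by do ?case: ifP.
case: (boolP (y \in U)) => yU; first by do ?case: ifP.
have uU2 : u \notin U2 by move: uU; rewrite in_setU negb_or => /andP[].
have uU1 : u \notin U1 by move: uU; rewrite in_setU negb_or => /andP[].
have wU2 : w \notin U2 by move: wU; rewrite in_setU negb_or => /andP[].
have wU1 : w \notin U1 by move: wU; rewrite in_setU negb_or => /andP[].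
have yU1 : y \notin U1 by move: yU; rewrite in_setU negb_or => /andP[].
case: (boolP (u \in B)) => uB; case: (boolP (w \in B)) => wB.
- move=> _ E; suff : false by [].
  by apply: (no_mono _ _ _ _ (fBP u y w _ _ _ uw uy yw E));
     rewrite ?in_setD ?in_setC ?uB ?wB ?uU2 ?wU2.
- by case: ifP.
- by case: ifP.
case: (boolP (y \in B)) => yB; first by case: ifP.
case: (boolP (u \in H)) => uH; case: (boolP (w \in H)) => wH //.
(* A clash within [L] would put [y] in [B], which lies on a higher level. *)
- move=> _ E; move: yB; rewrite (fLP u y w _ _ _ uw uy yw E) //.
  + by rewrite in_setD uU1.
  + by rewrite in_setD wU1.
  + by rewrite in_setC.
case: (boolP (y \in H)) => yH //.
move=> _ E; suff : false by [].
apply: (no_mono _ _ _ _ (fRP u y w _ _ _ uw uy yw E)).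
- by rewrite in_setC 2!in_setU (negPf uU) (negPf uH) (negPf uB).
- by rewrite in_setC 2!in_setU (negPf wU) (negPf wH) (negPf wB).
- by rewrite in_setC 2!in_setU (negPf yU) (negPf yH) (negPf yB).
Qed.

End Levels.

Lemma vr_number_cube (d K : nat) : degenerate d G -> 0 < K -> #|G| <= K ^ 3 ->
  vr_number 2 G <= (13 * d.+1 ^ 2 + 4) * K.
Proof.
move=> /degenerate_order[r r_inj rd] K0 GK.
rewrite /vr_number; case: ex_minnP => m _; apply; apply/asboolP.
apply: (vr_colourable_cube r_inj) => // v.
(* Being its own parent gives each vertex up to [d.+1] parents. *)
have sub : [set u | parent r u v] \subset v |: [set u | edge u v && (r u < r v)].
  apply/subsetP => u; rewrite !inE /parent /cadj ltn_neqAle (inj_eq r_inj).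
  by case: eqVneq.
by apply: leq_trans (subset_leq_card sub) _; rewrite cardsU1; have := rd v; lia.
Qed.

End Graph.

Theorem theorem1 (R : realType) (d : nat) (d_gt0 : (0 < d)%N) :
  exists c : R, forall n : nat, (d <= n)%N -> (2 <= n)%N ->
    forall G : sgraph, #|G| = n -> degenerate d G ->
      (vr_number 2 G)%:R <= c * (n%:R `^ (3%:R)^-1) * ln (n%:R).
Proof.
pose C := (13 * d.+1 ^ 2 + 4)%N.
(* The factor 2 pays for rounding [x >= 1] up to the integer [K]; dividing by [ln 2] makes the
   logarithmic factor at least 1. *)
exists (C%:R * 2 / ln 2) => n _ n2 G Gn degG.
set x := n%:R `^ _.
have ln2_gt0 : 0 < ln 2 :> R by rewrite ln_gt0 // ltr1n.
have ln2n : ln 2 <= ln n%:R :> R by rewrite ler_ln ?posrE ?ltr0n ?ler_nat //; lia.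
have x1 : 1 <= x by rewrite -(powRr0 n%:R) ler_powR ?ler1n ?invr_ge0 //; lia.
have x3 : x ^+ 3 = n%:R.
  by rewrite -powR_mulrn ?powR_ge0 // /x -powRrM mulVf ?powRr1 ?ler0n ?pnatr_eq0.
have x0 : 0 <= x by apply: le_trans x1.
pose K := (Num.trunc x).+1.
have xK : x < K%:R by exact: truncnS_gt.
have Kx : K%:R <= 2 * x.
  by rewrite /K -natr1 mulr2n mulrDl mul1r lerD // truncn_le.
have GK : (#|G| <= K ^ 3)%N.
  by rewrite Gn -(ler_nat R) natrX -x3 lerXn2r ?nnegrE // ltW.
have := vr_number_cube degG (ltn0Sn _) GK; rewrite -/C -(ler_nat R) natrM.
move=> bound. apply: le_trans bound _.
apply: (@le_trans _ _ (C%:R * (2 * x))); first by rewrite ler_wpM2l.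
rewrite -!mulrA ler_wpM2l // ler_wpM2l // mulrCA ler_peMr //.
by rewrite mulrC ler_pdivlMr ?mul1r.
Qed.
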